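(* Let $(S_n)_{n\in\mathbb{Z}}$ and $(A_n)_{n\in\mathbb{Z}}$ both be i.i.d. sequences taking non-negative integer values, independent of each other, with $\mathbb{E}S_n>\mathbb{E}A_n$. Let $X_n$ and $Y_n$ be the queue lengths before and after the arrival at time $n$ in the batch queue with arrivals $(A_n)$ and services $(S_n)$ (defined in the context). (a) If $A_n$ has a $\mathrm{Ber}(\cdot)\mathrm{Geom}(\cdot)$ distribution (for some values of the two parameters), then both $X_n$ and $Y_n$ have $\mathrm{Ber}(\cdot)\mathrm{Geom}(\cdot)$ distributions (each for some values of the parameters). (b) If $A_n$ takes values $0$ and $1$ only, then $X_n$ has a $\mathrm{Geom}^0$ distribution (for some value of the parameter). (c) If $A_n$ has a $\mathrm{Geom}^0$ (respectively $\mathrm{Geom}^+$) distribution, then $Y_n$ also has a $\mathrm{Geom}^0$ (respectively $\mathrm{Geom}^+$) distribution (for some value of the parameter).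
   Context: Distributions. For $\alpha\in(0,1)$, $\mathrm{Geom}^+(\alpha)$ is the law with $\mathbb{P}(X=k)=\alpha(1-\alpha)^{k-1}$ for integers $k\ge1$, and $\mathrm{Geom}^0(\alpha)$ is the law of $X-1$ when $X\sim\mathrm{Geom}^+(\alpha)$. $\mathrm{Ber}(p)\mathrm{Geom}(\alpha)$ is the law of the product of two independent random variables, one Bernoulli with parameter $p$ (value $1$ with probability $p$, value $0$ with probability $1-p$) and the other $\mathrm{Geom}^+(\alpha)$; that is, $\mathbb{P}(A=0)=1-p$ and $\mathbb{P}(A=k)=p\alpha(1-\alpha)^{k-1}$ for integers $k\ge1$. Batch queue. At time slot $n$, $A_n$ customers arrive, and then service is available for $S_n$ customers. The queue length $X_n$ after the service $S_{n-1}$ and before the arrival $A_n$ is $$X_n=\max_{m\le n}\sum_{r=m}^{n-1}(A_r-S_r)$$ (maximum over integers $m\le n$, with an empty sum equal to $0$), which is almost surely finite since $\mathbb{E}A_n<\mathbb{E}S_n$, and which satisfies $X_{n+1}=\max\{X_n+A_n-S_n,0\}$. The queue length after the arrival $A_n$ and before the service $S_n$ is $Y_n=X_n+A_n$.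
   Formalization: In (b) the Geom^0 parameter is allowed to equal 1 (X_n = 0 almost surely); it is shown to be less than 1 when P(A_n = 1) > 0 and P(S_n = 0) > 0, since otherwise X_n = 0 almost surely and no parameter in (0,1) works. *)

(* Defs.v *)
From mathcomp Require Import all_boot all_order all_algebra finmap.
From mathcomp Require Import all_classical all_reals all_analysis.

Set Implicit Arguments.
Unset Strict Implicit.
Unset Printing Implicit Defensive.

Import Order.TTheory GRing.Theory Num.Theory.

Local Open Scope classical_set_scope.
Local Open Scope ring_scope.

Section Independence.
Context d d' (T : measurableType d) (T' : measurableType d') (R : realType).
Variable P : probability T R.

Definition identically_distributed (I : Type) (X : I -> {RV P >-> T'}) : Prop :=
  forall (i j : I) (B : set T'), measurable B ->
    distribution P (X i) B = distribution P (X j) B.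

Definition mutually_independent (I : choiceType) (X : I -> {RV P >-> T'}) :
    Prop :=
  forall (J : {fset I}) (B : I -> set T'), (forall i, measurable (B i)) ->
    P (\bigcap_(i in [set` J]) (X i @^-1` B i)) =
    (\prod_(i <- J) P (X i @^-1` B i))%E.

Definition iid (I : choiceType) (X : I -> {RV P >-> T'}) : Prop :=
  identically_distributed X /\ mutually_independent X.

(* The sigma-algebra on T generated by the whole family X. *)
Definition family_sigma (I : Type) (X : I -> {RV P >-> T'}) : set (set T) :=
  <<s \bigcup_i preimage_set_system setT (X i) measurable >>.

Definition independent_families (I J : Type)
    (X : I -> {RV P >-> T'}) (Y : J -> {RV P >-> T'}) : Prop :=
  forall E F : set T, family_sigma X E -> family_sigma Y F ->
    P (E `&` F) = (P E * P F)%E.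

End Independence.

Section Laws.
Context d (T : measurableType d) (R : realType).
Variable P : probability T R.

Definition geomp_pmf (a : R) (k : nat) : R :=
  if k is j.+1 then a * (1 - a) ^+ j else 0.

(* Law of X - 1 when X has mass function geomp_pmf a. *)
Definition geom0_pmf (a : R) (k : nat) : R := geomp_pmf a k.+1.

Definition ber_geom_pmf (p a : R) (k : nat) : R :=
  if k is 0%N then 1 - p else p * geomp_pmf a k.

(* Each mass function f used below sums to 1 over nat, so has_pmf Z f
   determines the law of Z; in particular Z is then almost surely a finite
   natural number. *)
Definition has_pmf (Z : T -> \bar R) (f : nat -> R) : Prop :=
  forall k : nat, P [set w | Z w = k%:R%:E] = (f k)%:E.

Definition has_geomp (Z : T -> \bar R) : Prop :=
  exists a : R, 0 < a < 1 /\ has_pmf Z (geomp_pmf a).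

Definition has_geom0 (Z : T -> \bar R) : Prop :=
  exists a : R, 0 < a < 1 /\ has_pmf Z (geom0_pmf a).

Definition has_ber_geom (Z : T -> \bar R) : Prop :=
  exists p a : R, [/\ 0 <= p <= 1, 0 < a < 1 & has_pmf Z (ber_geom_pmf p a)].

End Laws.

Section Queue.
Context (T : Type) (R : realType).
Variables A S : int -> T -> nat.

(* The sum over r from m to n - 1 of A_r - S_r, for m <= n. *)
Definition net_input (m n : int) (w : T) : R :=
  \sum_(i < `|n - m|%N) ((A (m + i%:Z) w)%:R - (S (m + i%:Z) w)%:R).

(* A supremum of integers is a maximum as soon as it is finite; when no maximum
   exists the queue length is +oo. *)
Definition queue_before (n : int) (w : T) : \bar R :=
  ereal_sup [set (net_input m n w)%:E | m in [set m : int | m <= n]].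

Definition queue_after (n : int) (w : T) : \bar R :=
  (queue_before n w + (A n w)%:R%:E)%E.

End Queue.

(* Main.v *)
Require Import Defs.
From mathcomp Require Import all_boot all_order all_algebra finmap.
From mathcomp Require Import all_classical all_reals all_analysis.
From mathcomp Require Import measurable_realfun.
From mathcomp Require Import zify ring lra.

(* Write q for the probability that the walk of the increments A_r - S_r (read
   backwards from time n) ever exceeds 0, and f k for P(X_n >= k).  The only
   property of the arrivals used for X_n is that, given A >= m >= 1, equality
   A = m has a probability al not depending on m; al = 1 when A <= 1.  Hence
   the walk, on first reaching k >= 1, lands exactly on k with probability al, in
   which case it must climb afresh to reach k + 1, and otherwise it has already
   overshot.  So f (k + 1) = (1 - al + al q) f k.  Negative drift makes f L < 1
   for some L, so q < 1, and X_n is BerGeom(q, al (1 - q)); convolving with the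
   independent A_n gives the law of Y_n. *)

Set Implicit Arguments.
Unset Strict Implicit.
Unset Printing Implicit Defensive.

Import Order.TTheory GRing.Theory Num.Theory.
Import numFieldNormedType.Exports.

Local Open Scope classical_set_scope.
Local Open Scope ring_scope.

(** * Real-valued probabilities and means of natural-valued variables *)

Section RealProbability.
Context d (T : measurableType d) (R : realType).
Variable P : probability T R.

Definition pr (E : set T) : R := fine (P E).

Lemma prE (E : set T) : measurable E -> P E = (pr E)%:E.
Proof. by move=> mE; rewrite /pr fineK// fin_num_measure. Qed.

Lemma pr_ge0 (E : set T) : 0 <= pr E.
Proof. exact: fine_ge0. Qed.

Lemma pr_setT : pr setT = 1.
Proof. by rewrite /pr probability_setT. Qed.

Lemma pr_set0 : pr set0 = 0.
Proof. by rewrite /pr measure0. Qed.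

Lemma le_pr (E F : set T) : measurable E -> measurable F ->
  E `<=` F -> pr E <= pr F.
Proof. by move=> mE mF EF; rewrite -lee_fin -!prE// le_measure// inE. Qed.

Lemma pr_setIC (E F : set T) : measurable E -> measurable F ->
  pr E = pr (E `&` F) + pr (E `&` ~` F).
Proof.
move=> mE mF; apply: EFin_inj; rewrite EFinD -!prE//; first last.
- exact: measurableI.
- by apply: measurableI => //; exact: measurableC.
rewrite -setDE addeC; exact: measureDI.
Qed.

Lemma measurable_natI (Z : T -> nat) (U : set nat) : measurable_fun setT Z ->
  measurable (Z @^-1` U).
Proof. by move=> mZ; rewrite -[_ @^-1` _]setTI; exact: mZ. Qed.

Lemma pr_sum_lt (E : set T) (Z : T -> nat) (m : nat) :
  measurable E -> measurable_fun setT Z ->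
  pr E = \sum_(i < m) pr (E `&` Z @^-1` [set (i : nat)]) +
         pr (E `&` Z @^-1` [set k | (m <= k)%N]).
Proof.
move=> mE mZ; elim: m => [|m IH].
  rewrite big_ord0 add0r; congr pr; apply/seteqP; split=> x //=; last by case.
rewrite big_ord_recr/= IH -addrA; congr (_ + _).
have mm U : measurable (E `&` Z @^-1` U).
  by apply: measurableI => //; exact: measurable_natI.
rewrite (pr_setIC (mm [set k | (m <= k)%N]) (measurable_natI [set m] mZ)).
congr (_ + _); congr pr; apply/seteqP; split => x /=.
- by case=> -[].
- by case=> Ex Zx; split => //; split => //; rewrite Zx.
- by case=> -[Ex mZx] nZx; split => //; rewrite ltn_neqAle mZx andbT; apply/eqP => /esym.
- by case=> Ex Zx; split; [split => //; exact: ltnW|lia].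
Qed.

Lemma pr_nneseries (E : set T) (Z : T -> nat) :
  measurable E -> measurable_fun setT Z ->
  (pr E)%:E = (\sum_(0 <= i <oo) (pr (E `&` Z @^-1` [set i]))%:E)%E.
Proof.
move=> mE mZ.
have mm U : measurable (E `&` Z @^-1` U).
  by apply: measurableI => //; exact: measurable_natI.
rewrite -prE//.
rewrite [LHS](_ : _ = P (\bigcup_i (E `&` Z @^-1` [set i]))); last first.
  congr (P _); apply/seteqP; split => x /=; last by case=> i _ [].
  by move=> Ex; exists (Z x).
rewrite measure_semi_bigcup//.
- by apply: eq_eseriesr => i _; exact: prE.
- by move=> i j _ _ [x [[_ <-] [_ <-]]].
- exact: bigcupT_measurable.
Qed.

Definition mean (Z : T -> nat) : \bar R := (\int[P]_w (Z w)%:R%:E)%E.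

Lemma measurable_natr (Z : T -> nat) : measurable_fun setT Z ->
  measurable_fun setT (fun w => (Z w)%:R%:E : \bar R).
Proof.
move=> mZ; apply: (measurableT_comp (f := fun k : nat => k%:R%:E) _ mZ).
by move=> ? ? ?; exact: I.
Qed.

Lemma measurable_nat_comp (g : nat -> nat) (Z : T -> nat) :
  measurable_fun setT Z -> measurable_fun setT (g \o Z).
Proof.
move=> mZ; apply: (measurableT_comp (f := g) _ mZ).
by move=> ? ? ?; exact: I.
Qed.

Lemma mean_ge0 (Z : T -> nat) : (0 <= mean Z)%E.
Proof. by apply: integral_ge0 => w _; rewrite lee_fin. Qed.

Lemma meanD (Z1 Z2 : T -> nat) :
  measurable_fun setT Z1 -> measurable_fun setT Z2 ->
  mean (fun w => (Z1 w + Z2 w)%N) = (mean Z1 + mean Z2)%E.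
Proof.
move=> m1 m2; rewrite /mean -ge0_integralD//; first last.
- exact: measurable_natr.
- exact: measurable_natr.
by apply: eq_integral => w _; rewrite natrD EFinD.
Qed.

Lemma le_mean (Z1 Z2 : T -> nat) :
  measurable_fun setT Z1 -> measurable_fun setT Z2 ->
  (forall w, (Z1 w <= Z2 w)%N) -> (mean Z1 <= mean Z2)%E.
Proof.
move=> m1 m2 le12; apply: ge0_le_integral => //.
- exact: measurable_natr.
- exact: measurable_natr.
- by move=> w _; rewrite lee_fin ler_nat.
Qed.

Lemma mean_nat_indic (E : set T) (L : nat) : measurable E ->
  mean (fun w => (L * (w \in E))%N) = (L%:R * pr E)%:E.
Proof.
move=> mE; rewrite EFinM -prE// -[E in RHS]setIT -integral_indic//.
rewrite -ge0_integralZl_EFin//.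
  by apply: eq_integral => w _; rewrite natrM indicE EFinM.
by apply/measurable_EFinP; exact: measurable_indic.
Qed.

Lemma mean_identically_distributed (X Y : {RV P >-> nat}) (g : nat -> nat) :
  (forall B, measurable B -> distribution P X B = distribution P Y B) ->
  mean (g \o X) = mean (g \o Y).
Proof.
move=> XY; have meanE (Z : {RV P >-> nat}) :
    mean (g \o Z) = (\int[distribution P Z]_k (g k)%:R%:E)%E.
  by rewrite ge0_integral_pushforward//= => k _; rewrite lee_fin.
by rewrite !meanE; apply: eq_measure_integral => B mB _; exact: XY.
Qed.

(** By monotone convergence the means of the truncations of [Z] increase to its mean, so a strict
    lower bound survives at some level. This also covers services of infinite mean. *)
Lemma mean_minn_gt (Z : T -> nat) (c : \bar R) : measurable_fun setT Z ->
  (c < mean Z)%E -> exists L, (c < mean (fun w => minn (Z w) L))%E.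
Proof.
move=> mZ cZ; apply: contrapT => /forallNP H.
move: cZ; apply/negP; rewrite -leNgt.
have mm L : measurable_fun setT (fun w => minn (Z w) L).
  exact: (measurable_nat_comp (minn^~ L)).
have limE w : limn (fun L => (minn (Z w) L)%:R%:E : \bar R) = (Z w)%:R%:E.
  apply/cvg_lim => //; apply: cvg_near_cst; exists (Z w) => // L /= ZL.
  by rewrite (minn_idPl ZL).
have -> : mean Z =
    (\int[P]_w limn (fun L => (minn (Z w) L)%:R%:E))%E.
  by apply: eq_integral => w _; rewrite limE.
have nd w : {homo (fun L => (minn (Z w) L)%:R%:E : \bar R) :
    a b / (a <= b)%N >-> (a <= b)%E}.
  move=> a b ab; rewrite lee_fin ler_nat leq_min geq_minl/=.
  exact: leq_trans (geq_minr _ _) ab.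
rewrite monotone_convergence//.
- apply: lime_le.
    apply: ereal_nondecreasing_is_cvgn => a b ab.
    apply: ge0_le_integral => //.
    + exact: measurable_natr (mm a).
    + exact: measurable_natr (mm b).
    + by move=> w _; exact: nd.
  by apply: nearW => L; rewrite leNgt; apply/negP; exact: H.
- by move=> L; exact: measurable_natr.
Qed.

End RealProbability.

(** * The queue recursion and its independence of later slots *)

Section BatchQueue.
Context d (T : measurableType d) (R : realType).
Variable P : probability T R.
Variables A S : int -> {RV P >-> nat}.

Notation pr := (pr P).

(* The queue length just before time n if the queue was empty at time n - t. *)
Fixpoint queue (t : nat) (n : int) (w : T) : nat :=
  if t is u.+1 then (queue u (n - 1) w + A (n - 1) w - S (n - 1) w)%N else 0%N.

Lemma measurable_queue t n : measurable_fun setT (queue t n).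
Proof.
elim: t n => [|t IH] n /=; first exact: measurable_cst.
by apply: measurable_fun_subn => //; exact: measurable_fun_addn.
Qed.

Lemma leq_queueS t n w : (queue t n w <= queue t.+1 n w)%N.
Proof.
by elim: t n => // t IH n; rewrite [leqRHS]/= leq_sub2r// leq_add2r.
Qed.

Lemma leq_queue t u n w : (t <= u)%N -> (queue t n w <= queue u n w)%N.
Proof.
by move=> tu; apply: (homo_leq (f := fun t => queue t n w) leqnn leq_trans _ tu)
  => i; exact: leq_queueS.
Qed.

Definition cylinder (J : {fset int}) (B C : int -> set nat) : set T :=
  \bigcap_(i in [set` J]) (A i @^-1` B i) `&`
  \bigcap_(i in [set` J]) (S i @^-1` C i).

(** Rectangles over finitely many slots suffice: the recursion conditions on one slot at a time, and
    a rectangle has an explicit product probability. *)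
Definition future (n : int) (E : set T) : Prop :=
  exists J B C, (forall i : int, i \in J -> n <= i) /\ E = cylinder J B C.

Lemma measurable_future n E : future n E -> measurable E.
Proof.
by case=> J [B [C [_ ->]]]; apply: measurableI;
  apply: fin_bigcap_measurable => // i _; exact: measurable_funPTI.
Qed.

Lemma future_setT n : future n setT.
Proof.
exists fset0, (fun=> setT), (fun=> setT); split => //.
by rewrite /cylinder set_fset0 !bigcap_set0 setTI.
Qed.

Hypotheses (iidA : iid A) (iidS : iid S) (indepAS : independent_families A S).

Lemma family_sigma_bigcap (X : int -> {RV P >-> nat}) (J : {fset int})
  (B : int -> set nat) :
  family_sigma X (\bigcap_(i in [set` J]) (X i @^-1` B i)).
Proof.
pose G := \bigcup_i preimage_set_system setT (X i) measurable.
apply: (@fin_bigcap_measurable _ (g_sigma_algebraType G)) => // i _.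
apply: sub_sigma_algebra; exists i => //; exists (B i) => //.
by rewrite setTI.
Qed.

Lemma prob_cylinder J B C : P (cylinder J B C) =
  ((\prod_(i <- J) P (A i @^-1` B i)) * (\prod_(i <- J) P (S i @^-1` C i)))%E.
Proof.
rewrite /cylinder indepAS; [|exact: family_sigma_bigcap..].
by rewrite iidA.2// iidS.2.
Qed.

Lemma prob_arrival n U : P (A n @^-1` U) = P (A 0 @^-1` U).
Proof. exact: (iidA.1 n 0 U). Qed.

Lemma prob_service n U : P (S n @^-1` U) = P (S 0 @^-1` U).
Proof. exact: (iidS.1 n 0 U). Qed.

(** Every index of [J] is at least [n], so slot [n - 1] is new: adding it to the rectangle
    multiplies the probability by two factors, moved to slot 0 by stationarity. *)
Lemma future_slot n E U V : future n E ->
  let F := E `&` (A (n - 1) @^-1` U `&` S (n - 1) @^-1` V) in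
  future (n - 1) F /\ pr F = pr E * (pr (A 0 @^-1` U) * pr (S 0 @^-1` V)).
Proof.
case=> J [B [C [Jn ->]]] F; set m := n - 1.
have mJ : m \notin J by apply/negP => /Jn; rewrite /m; lia.
pose upd (B : int -> set nat) U i := if i == m then U else B i.
have updJ B' U' (i : int) : i \in J -> upd B' U' i = B' i.
  by rewrite /upd; case: eqP => // -> mJ'; rewrite mJ' in mJ.
have capU B' U' (X : int -> {RV P >-> nat}) :
    \bigcap_(i in [set` (m |` J)%fset]) (X i @^-1` upd B' U' i) =
    (X m @^-1` U') `&` \bigcap_(i in [set` J]) (X i @^-1` B' i).
  apply/seteqP; split => x /=.
    move=> H; split.
      by have := H m; rewrite /upd eqxx; apply; rewrite /= !inE eqxx.
    move=> i iJ; rewrite -(updJ _ U')//; apply: H.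
    by rewrite /= !inE; apply/orP; right.
  case=> xm H i /=; rewrite !inE => /orP[/eqP->|iJ].
    by rewrite /upd eqxx.
  by rewrite [upd _ _ _]updJ//; exact: H.
have FE : F = cylinder (m |` J)%fset (upd B U) (upd C V).
  rewrite /F /cylinder !capU -/m; apply/seteqP; split=> x /=; tauto.
have fF : future m F.
  exists (m |` J)%fset, (upd B U), (upd C V); split => // i.
  by rewrite !inE => /orP[/eqP->//|/Jn]; rewrite /m; lia.
have mF := measurable_future fF.
have mcyl : measurable (cylinder J B C).
  by apply: (@measurable_future n); exists J, B, C.
split=> //; apply: EFin_inj.
rewrite !EFinM -!prE//; [|exact: measurable_funPTI..].
have updm B' U' : upd B' U' m = U' by rewrite /upd eqxx.
have prodU B' U' (X : int -> {RV P >-> nat}) :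
    (\prod_(i <- J) P (X i @^-1` upd B' U' i) =
     \prod_(i <- J) P (X i @^-1` B' i))%E.
  by rewrite big_seq [RHS]big_seq; apply: eq_bigr => i iJ; rewrite updJ.
rewrite FE !prob_cylinder !big_fsetU1//= !updm !prodU.
rewrite prob_arrival prob_service.
by rewrite muleACA muleC.
Qed.

Definition arrival_pmf i := pr (A 0 @^-1` [set i]).
Definition arrival_tail m := pr (A 0 @^-1` [set i | (m <= i)%N]).
Definition service_pmf i := pr (S 0 @^-1` [set i]).
Definition queue_tail t k := pr (queue t 0 @^-1` [set i | (k <= i)%N]).

(* [arrival_step F m] is the tail at m of V + A with V independent of A and
   [F k] the tail at k of V. *)
Definition arrival_step (F : nat -> R) (m : nat) : R :=
  \sum_(i < m) arrival_pmf i * F (m - i)%N + arrival_tail m.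

(** Named so that the one-step expansion below can take it as a hypothesis, both inside the
    induction that proves it and afterwards. As [queue_tail] lives at time 0, it includes
    stationarity. *)
Let past_indep t := forall n E k, future n E ->
  pr (E `&` queue t n @^-1` [set i | (k <= i)%N]) = pr E * queue_tail t k.

(** Split on the service s and the arrival i of slot [n - 1]. As the level is positive, truncation
    at 0 is harmless: the earlier queue must reach k + 1 + s - i. The slot joins [E] to form a
    future event of [n - 1]; once i >= k + 1 + s nothing is asked of the queue, whence the tail
    term. *)
Let pr_step t n E k : past_indep t -> future n E ->
  (pr (E `&` queue t.+1 n @^-1` [set i | (k < i)%N]))%:E =
  ((pr E)%:E * \sum_(0 <= s <oo)
     (service_pmf s * arrival_step (queue_tail t) (k.+1 + s))%:E)%E.
Proof.
move=> indt fE; rewrite -nneseriesZl; last first.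
  move=> s _; rewrite lee_fin mulr_ge0 ?pr_ge0// addr_ge0 ?pr_ge0//.
  by apply: sumr_ge0 => i _; rewrite mulr_ge0 ?pr_ge0.
have mE := measurable_future fE.
have mA := measurable_natI _ (measurable_funPT (A (n - 1))).
have mS := measurable_natI _ (measurable_funPT (S (n - 1))).
have mQ := measurable_natI _ (measurable_queue t.+1 n).
rewrite (pr_nneseries P (measurableI _ _ mE (mQ _)) (measurable_funPT (S (n - 1)))).
apply: eq_eseriesr => s _; rewrite -EFinM; congr EFin.
rewrite (@pr_sum_lt _ _ _ P _ (A (n - 1)) (k.+1 + s)) ?measurable_funPT//; last first.
  by apply: measurableI => //; apply: measurableI.
rewrite /arrival_step !mulrDr !mulr_sumr; congr (_ + _).
  apply: eq_bigr => i _.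
  have [fF prF] := future_slot [set (i : nat)] [set s] fE.
  transitivity (pr E * (arrival_pmf i * service_pmf s) *
    queue_tail t (k.+1 + s - i)); last by ring.
  rewrite -prF -(indt _ _ _ fF); congr pr; apply/seteqP; split => x /=.
    case=> -[[Ex]] kQ Ss Ai; rewrite Ai Ss in kQ *.
    by do ![split => //]; have := ltn_ord i; lia.
  case=> -[Ex [Ai Ss]] kQ; rewrite Ai Ss.
  by do ![split => //]; have := ltn_ord i; lia.
have [_ prF] := future_slot [set i | (k.+1 + s <= i)%N] [set s] fE.
transitivity (pr E * (arrival_tail (k.+1 + s) * service_pmf s)); last by ring.
rewrite -prF; congr pr; apply/seteqP; split => x /=.
  by case=> -[[Ex]] kQ Ss Ai.
by case=> Ex [Ai Ss]; do ![split => //]; lia.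
Qed.

(** At a positive level both sides expand by [pr_step], the right one at time 0 with the full event,
    into the same series. *)
Lemma pr_future_queue t n E k : future n E ->
  pr (E `&` queue t n @^-1` [set i | (k <= i)%N]) = pr E * queue_tail t k.
Proof.
elim: t n E k => [|t IH] n E [|k] fE; last first.
- apply: EFin_inj; rewrite pr_step// EFinM; congr (_ * _)%E.
  rewrite /queue_tail -[X in pr X]setTI (pr_step k IH (future_setT 0)).
  by rewrite pr_setT mul1e.
- rewrite /queue_tail.
  have T0 m : queue t.+1 m @^-1` [set i | (0 <= i)%N] = setT by apply/seteqP.
  by rewrite !T0 setIT pr_setT mulr1.
- rewrite /queue_tail (_ : _ @^-1` _ = set0); last by apply/seteqP; split.
  by rewrite setI0 pr_set0 mulr0.
- rewrite /queue_tail.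
  have T0 m : queue 0 m @^-1` [set i | (0 <= i)%N] = setT by apply/seteqP.
  by rewrite !T0 setIT pr_setT mulr1.
Qed.

Lemma queue_tailS t k : (queue_tail t.+1 k.+1)%:E =
  (\sum_(0 <= s <oo)
     (service_pmf s * arrival_step (queue_tail t) (k.+1 + s))%:E)%E.
Proof.
rewrite /queue_tail -[X in pr X]setTI (pr_step k _ (future_setT 0)).
  by rewrite pr_setT mul1e.
by move=> n E j; exact: pr_future_queue.
Qed.

Lemma queue_tail0 t : queue_tail t 0 = 1.
Proof. by rewrite /queue_tail -(pr_setT P); congr pr; apply/seteqP. Qed.

Lemma queue_tail0S k : queue_tail 0 k.+1 = 0.
Proof. by rewrite /queue_tail -(pr_set0 P); congr pr; apply/seteqP; split. Qed.

Lemma queue_tail_ge0 t k : 0 <= queue_tail t k.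
Proof. exact: pr_ge0. Qed.

Lemma queue_tail_le1 t k : queue_tail t k <= 1.
Proof.
rewrite -(pr_setT P); apply: le_pr => //.
exact/measurable_natI/measurable_queue.
Qed.

Lemma queue_tail_homo k : {homo queue_tail^~ k : t u / (t <= u)%N >-> t <= u}.
Proof.
move=> t u tu; apply: le_pr; [exact/measurable_natI/measurable_queue..|].
by move=> w /= kt; exact: leq_trans kt (leq_queue _ _ tu).
Qed.

Lemma arrival_step_ge0 F m : (forall k, 0 <= F k) -> 0 <= arrival_step F m.
Proof.
move=> F0; rewrite addr_ge0 ?pr_ge0//.
by apply: sumr_ge0 => i _; rewrite mulr_ge0 ?pr_ge0.
Qed.

Lemma arrival_tailE m : arrival_tail m = arrival_pmf m + arrival_tail m.+1.
Proof.
have mm U : measurable (A 0 @^-1` U) by exact: measurable_funPTI.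
rewrite /arrival_tail (pr_setIC P (mm [set i | (m <= i)%N]) (mm [set m])).
by congr (_ + _); congr pr; apply/seteqP; split => x /=; lia.
Qed.

(** * Tail ratios of the finite-time queue for arrivals with a geometric tail *)

Section GeometricTail.
Variable al : R.
Hypothesis al01 : 0 < al <= 1.
Hypothesis tailA :
  forall m, (0 < m)%N -> arrival_tail m.+1 = (1 - al) * arrival_tail m.

Let ratio_ge0 q : 0 <= q -> 0 <= 1 - al + al * q.
Proof.
move=> q0; case/andP: al01 => al0 al1.
by have := mulr_ge0 (ltW al0) q0; lra.
Qed.

Lemma geometric_pmf m : (0 < m)%N -> arrival_pmf m = al * arrival_tail m.
Proof. by move=> m0; have := arrival_tailE m; rewrite tailA//; lra. Qed.

(** Arrivals i < m leave a positive level m - i, where [F] and [G] compare directly. Exactly m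
    arrivals have mass al times the tail at m and still need one level, at most q; more than m have
    the remaining share 1 - al. Together these give the factor 1 - al + al q. *)
Lemma arrival_stepS_le (F G : nat -> R) q m : (0 < m)%N -> 0 <= q ->
  (forall k, (0 < k)%N -> G k.+1 <= (1 - al + al * q) * F k) -> G 1%N <= q ->
  arrival_step G m.+1 <= (1 - al + al * q) * arrival_step F m.
Proof.
move=> m0 q0 FG Gq; rewrite /arrival_step big_ord_recr/= subSnn tailA// geometric_pmf//.
have T0 : 0 <= arrival_tail m by exact: pr_ge0.
have H1 : al * arrival_tail m * G 1%N <= al * arrival_tail m * q.
  by rewrite ler_wpM2l// mulr_ge0//; case/andP: al01 => /ltW.
have H2 : \sum_(i < m) arrival_pmf i * G (m.+1 - i)%N <=
    (1 - al + al * q) * \sum_(i < m) arrival_pmf i * F (m - i)%N.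
  rewrite mulr_sumr; apply: ler_sum => i _.
  rewrite mulrCA ler_wpM2l ?pr_ge0// subSn; last exact: ltnW.
  by apply: FG; rewrite subn_gt0.
nra.
Qed.

Lemma arrival_stepS_ge (F G : nat -> R) q m : (0 < m)%N -> 0 <= q ->
  (forall k, (0 < k)%N -> (1 - al + al * q) * F k <= G k.+1) -> q <= G 1%N ->
  (1 - al + al * q) * arrival_step F m <= arrival_step G m.+1.
Proof.
move=> m0 q0 FG Gq; rewrite /arrival_step big_ord_recr/= subSnn tailA// geometric_pmf//.
have T0 : 0 <= arrival_tail m by exact: pr_ge0.
have H1 : al * arrival_tail m * q <= al * arrival_tail m * G 1%N.
  by rewrite ler_wpM2l// mulr_ge0//; case/andP: al01 => /ltW.
have H2 : (1 - al + al * q) * \sum_(i < m) arrival_pmf i * F (m - i)%N <=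
    \sum_(i < m) arrival_pmf i * G (m.+1 - i)%N.
  rewrite mulr_sumr; apply: ler_sum => i _.
  rewrite mulrCA ler_wpM2l ?pr_ge0// subSn; last exact: ltnW.
  by apply: FG; rewrite subn_gt0.
nra.
Qed.

(** In the expansions at k + 1 and k the service weights agree, so the series compare term by term,
    with [queue_tail t] as both [F] and [G]. *)
Lemma queue_tail_ratio_le q t k : (0 < k)%N -> 0 <= q ->
  (forall u, queue_tail u 1 <= q) ->
  queue_tail t k.+1 <= (1 - al + al * q) * queue_tail t k.
Proof.
move=> k0 q0 tq; have be0 : 0 <= 1 - al + al * q := ratio_ge0 q0.
elim: t k k0 => [|t IH] [//|k] _; first by rewrite !queue_tail0S mulr0.
rewrite -lee_fin EFinM !queue_tailS -nneseriesZl; last first.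
  by move=> s _; rewrite lee_fin mulr_ge0 ?pr_ge0// arrival_step_ge0// => j;
    exact: pr_ge0.
apply: lee_nneseries => s _.
  by rewrite lee_fin mulr_ge0 ?pr_ge0// arrival_step_ge0// => j;
    exact: pr_ge0.
rewrite lee_fin mulrCA ler_wpM2l ?pr_ge0// addSn.
exact: arrival_stepS_le.
Qed.

(* The extra u slots leave the walk time to climb one more level after reaching k,
   so that the two bounds agree in the limit. *)
Lemma queue_tail_ratio_ge u t k : (0 < k)%N ->
  (1 - al + al * queue_tail u 1) * queue_tail t k <= queue_tail (t + u) k.+1.
Proof.
move=> k0; have q0 : 0 <= queue_tail u 1 := queue_tail_ge0 _ _.
have be0 : 0 <= 1 - al + al * queue_tail u 1 := ratio_ge0 q0.
elim: t k k0 => [|t IH] [//|k] _.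
  by rewrite !queue_tail0S mulr0 queue_tail_ge0.
rewrite -lee_fin EFinM addSn !queue_tailS -nneseriesZl; last first.
  by move=> s _; rewrite lee_fin mulr_ge0 ?pr_ge0// arrival_step_ge0// => j;
    exact: pr_ge0.
apply: lee_nneseries => s _.
  rewrite lee_fin !mulr_ge0 ?pr_ge0// arrival_step_ge0// => j;
    exact: pr_ge0.
rewrite lee_fin mulrCA ler_wpM2l ?pr_ge0// addSn.
apply: arrival_stepS_ge => //; exact/queue_tail_homo/leq_addl.
Qed.

End GeometricTail.

(** * The recursion and the supremum of net inputs *)

Lemma net_input_recr i n w :
  net_input R A S (n - i.+1%:Z) n w =
  net_input R A S (n - 1 - i%:Z) (n - 1) w +
  ((A (n - 1) w)%:R - (S (n - 1) w)%:R).
Proof.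
have E1 : `|(n - (n - i.+1%:Z))%R|%N = i.+1 by lia.
have E2 : `|(n - 1 - (n - 1 - i%:Z))%R|%N = i by lia.
rewrite /net_input E1 E2 big_ord_recr/=.
have -> : n - i.+1%:Z + i%:Z = n - 1 by lia.
have -> : n - 1 - i%:Z = n - i.+1%:Z by lia.
by [].
Qed.

Lemma net_input_int m n w : exists z : int, net_input R A S m n w = z%:~R.
Proof.
exists (\sum_(i < `|n - m|%N) ((A (m + i%:Z) w)%:Z - (S (m + i%:Z) w)%:Z)).
by rewrite /net_input rmorph_sum/=; apply: eq_bigr => i _; rewrite rmorphB/= !pmulrn.
Qed.

(** Lindley's formula in threshold form: unrolling the recursion turns the queue into the largest
    net input over the last i <= t slots. The induction peels off slot [n - 1]. *)
Lemma leq_queueP t n w k : (k <= queue t n w)%N <->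
  exists2 i, (i <= t)%N & k%:R <= net_input R A S (n - i%:Z) n w.
Proof.
have net0 m : net_input R A S (m - 0%:Z) m w = 0.
  have E0 : `|(m - (m - 0%:Z))%R|%N = 0%N by lia.
  by rewrite /net_input E0 big_ord0.
elim: t n k => [|t IH] n [|k]; try by split => // _; exists 0%N => //; rewrite net0.
  split => // -[i]; rewrite leqn0 => /eqP ->; rewrite net0 => ?.
  have : 0 < k.+1%:R :> R by rewrite ltr0n.
  lra.
have -> : (k < queue t.+1 n w)%N =
    (k.+1 + S (n - 1) w - A (n - 1) w <= queue t (n - 1) w)%N.
  by rewrite /=; lia.
rewrite IH; set a := A (n - 1) w; set s := S (n - 1) w.
(* If this slot alone reaches the level, the truncated difference is 0 and the window of length 1 is
   a witness; otherwise the subtraction is exact. *)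
have [ak|ka] := leqP (k.+1 + s) a.
  split=> _.
    exists 1%N => //.
    rewrite net_input_recr net0 add0r lerBrDr -natrD ler_nat.
    by rewrite -/a -/s.
  by exists 0%N => //; rewrite net0; have -> : (k.+1 + s - a = 0)%N by lia.
rewrite natrB ?natrD; last exact: ltnW.
split=> -[i it kn].
  by exists i.+1 => //; rewrite net_input_recr -/a -/s; lra.
case: i it kn => [|i] it kn.
  have : 0 < k.+1%:R :> R by rewrite ltr0n.
  by move: kn; rewrite net0; lra.
by exists i => //; move: kn; rewrite net_input_recr -/a -/s; lra.
Qed.

(** Net inputs are integers: if none reaches k + 1, all are at most k, and so is their supremum. *)
Lemma queue_before_ge n w k : (k%:R%:E <= queue_before R A S n w)%E <->
  exists t, (k <= queue t n w)%N.
Proof.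
split=> [kX|[t /leq_queueP[i _ ki]]]; last first.
  apply: le_trans (ereal_sup_ubound _); last first.
    by exists (n - i%:Z) => //=; lia.
  by rewrite lee_fin.
case: k kX => [_|k kX]; first by exists 0%N.
apply: contrapT => /forallNP kq; move: kX; apply/negP; rewrite -ltNge.
apply: (@le_lt_trans _ _ k%:R%:E); last by rewrite lte_fin ltr_nat.
apply: ge_ereal_sup => _ [m mn <-]; rewrite lee_fin leNgt; apply/negP => kX.
apply: (kq `|(n - m)%R|%N); apply/leq_queueP; exists `|(n - m)%R|%N => //.
have -> : n - `|(n - m)%R|%N%:Z = m by move: mn => /=; lia.
move: kX; have [z ->] := net_input_int m n w.
by rewrite !pmulrn ltr_int ler_int; lia.
Qed.

Lemma queue_before_eq n w k : (queue_before R A S n w = k%:R%:E) <->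
  (exists t, (k <= queue t n w)%N) /\ ~ (exists t, (k < queue t n w)%N).
Proof.
rewrite -!queue_before_ge; split=> [->|[kX kX1]].
  by split => //; rewrite lee_fin ler_nat ltnn.
apply/le_anti/andP; split => //.
apply: ge_ereal_sup => _ [m mn <-]; rewrite lee_fin leNgt; apply/negP => kn.
apply: kX1; apply: le_trans (ereal_sup_ubound _); last by exists m.
rewrite lee_fin; move: kn; have [z ->] := net_input_int m n w.
by rewrite !pmulrn ltr_int ler_int; lia.
Qed.

(** * Tails of the stationary queue length *)

Definition eventually_ge (n : int) (k : nat) : set T :=
  \bigcup_t (queue t n @^-1` [set i | (k <= i)%N]).

Lemma measurable_eventually_ge n k : measurable (eventually_ge n k).
Proof.
by apply: bigcupT_measurable => t; exact/measurable_natI/measurable_queue.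
Qed.

(** By [queue_before_ge] this is f k of the outline, and [limit_tail 1] is q. The event is an
    increasing union, so finite-time identities pass to the limit. *)
Definition limit_tail k : R := pr (eventually_ge 0 k).

Lemma future_queue_cvg n E k : future n E ->
  pr E * queue_tail t k @[t --> \oo] --> pr (E `&` eventually_ge n k).
Proof.
move=> fE; rewrite /eventually_ge setI_bigcupr.
under eq_cvg do rewrite -(pr_future_queue _ _ fE).
have mE t : measurable (E `&` queue t n @^-1` [set i | (k <= i)%N]).
  apply: measurableI; first exact: measurable_future fE.
  exact/measurable_natI/measurable_queue.
have mU := bigcupT_measurable _ mE.
apply: fine_cvg; rewrite -prE//.
apply: nondecreasing_cvg_mu => // i j ij; apply/subsetPset => w [Fw /= ki].
by split => //=; exact: leq_trans ki (leq_queue _ _ ij).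
Qed.

Lemma queue_tail_cvg k : queue_tail t k @[t --> \oo] --> limit_tail k.
Proof.
have := future_queue_cvg (k := k) (future_setT 0); rewrite setTI pr_setT.
by under eq_cvg do rewrite mul1r.
Qed.

Lemma pr_future_eventually_ge n E k : future n E ->
  pr (E `&` eventually_ge n k) = pr E * limit_tail k.
Proof.
move=> fE; have c1 : pr E * queue_tail t k @[t --> \oo] --> pr E * limit_tail k.
  by apply: cvgM; [exact: cvg_cst|exact: queue_tail_cvg].
exact: cvg_unique (future_queue_cvg fE) c1.
Qed.

Lemma limit_tail_leM k c b :
  (forall t, c * queue_tail t k <= b) -> c * limit_tail k <= b.
Proof.
move=> cb; have c1 : c * queue_tail t k @[t --> \oo] --> c * limit_tail k.
  by apply: cvgM; [exact: cvg_cst|exact: queue_tail_cvg].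
rewrite -(cvg_lim _ c1)//; apply: limr_le;
  first by apply/cvg_ex; exists (c * limit_tail k).
exact: nearW.
Qed.

Lemma queue_tail_le_limit t k : queue_tail t k <= limit_tail k.
Proof.
apply: le_pr; first exact/measurable_natI/measurable_queue.
  exact: measurable_eventually_ge.
by move=> w kw; exists t.
Qed.

Lemma limit_tail_le k b : (forall t, queue_tail t k <= b) -> limit_tail k <= b.
Proof.
move=> kb; rewrite -[limit_tail k]mul1r; apply: limit_tail_leM => t.
by rewrite mul1r.
Qed.

Lemma limit_tail_ge0 k : 0 <= limit_tail k.
Proof. exact: pr_ge0. Qed.

Lemma limit_tail_le1 k : limit_tail k <= 1.
Proof. by apply: limit_tail_le => t; exact: queue_tail_le1. Qed.

Lemma limit_tail0 : limit_tail 0 = 1.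
Proof.
apply/le_anti; rewrite limit_tail_le1/= -(queue_tail0 0).
exact: queue_tail_le_limit.
Qed.

(** One arrival and no service in the last slot already make the queue nonempty. *)
Lemma limit_tail1_gt0 : 0 < arrival_pmf 1 -> 0 < service_pmf 0 ->
  0 < limit_tail 1.
Proof.
move=> A1 S0; apply: lt_le_trans (queue_tail_le_limit 1 1).
have [fF prF] := future_slot [set 1%N] [set 0%N] (future_setT 0).
apply: (@lt_le_trans _ _ (arrival_pmf 1 * service_pmf 0)); first exact: mulr_gt0.
move: prF; rewrite pr_setT mul1r => <-; apply: le_pr.
- exact: measurable_future fF.
- exact/measurable_natI/measurable_queue.
by move=> w [_ [/= Aw Sw]]; rewrite Aw Sw.
Qed.

Section LimitGeometric.
Variable al : R.
Hypothesis al01 : 0 < al <= 1.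
Hypothesis tailA :
  forall m, (0 < m)%N -> arrival_tail m.+1 = (1 - al) * arrival_tail m.

Lemma limit_tail_ratio k : (0 < k)%N ->
  limit_tail k.+1 = (1 - al + al * limit_tail 1) * limit_tail k.
Proof.
move=> k0; have q0 := limit_tail_ge0 1; have f0 := limit_tail_ge0 k.
case/andP: (al01) => al0 al1.
apply/le_anti/andP; split.
  apply: limit_tail_le => t.
  apply: le_trans (queue_tail_ratio_le al01 tailA t k0 q0 _) _.
    by move=> u; exact: queue_tail_le_limit.
  rewrite ler_wpM2l ?queue_tail_le_limit//.
  by have := mulr_ge0 (ltW al0) q0; lra.
(* The lower bound is a product of two finite-time tails. Each inequality is rearranged to be linear
   in one of them, so that the limits in t and in u are taken separately. *)
suff : (al * limit_tail k) * limit_tail 1 <=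
       limit_tail k.+1 - (1 - al) * limit_tail k by lra.
apply: limit_tail_leM => u.
suff : (1 - al + al * queue_tail u 1) * limit_tail k <= limit_tail k.+1 by lra.
apply: limit_tail_leM => t.
exact: le_trans (queue_tail_ratio_ge al01 tailA u t k0) (queue_tail_le_limit _ _).
Qed.

Lemma limit_tail_geometric k :
  limit_tail k.+1 = limit_tail 1 * (1 - al + al * limit_tail 1) ^+ k.
Proof.
elim: k => [|k IH]; first by rewrite expr0 mulr1.
by rewrite limit_tail_ratio// IH exprS mulrCA.
Qed.

End LimitGeometric.

(** * Negative drift *)

Section Drift.
Hypothesis meanAS : forall n : int,
  ('E_P[fun w => (A n w)%:R] < 'E_P[fun w => (S n w)%:R])%E.

Let mean_lt n : (mean P (A n) < mean P (S n))%E.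
Proof. by have := meanAS n; rewrite unlock. Qed.

Let mA n : measurable_fun setT (A n) := measurable_funPT (A n).
Let mS n : measurable_fun setT (S n) := measurable_funPT (S n).
Let mQ t n : measurable_fun setT (queue t n) := @measurable_queue t n.

Let mean_arrival n : mean P (A n) = mean P (A 0).
Proof. exact: (mean_identically_distributed id (iidA.1 n 0)). Qed.

Let mean_arrival_fin : mean P (A 0) \is a fin_num.
Proof.
by rewrite ge0_fin_numE ?mean_ge0//; exact: lt_le_trans (mean_lt 0) (leey _).
Qed.

(** A single path started empty at time 0 and run forward, so consecutive values are linked by the
    recursion; [queue t 0] has the same law but a new starting time for each t. *)
Let Q (t : nat) := queue t t%:Z.

Let QS t w : Q t.+1 w = (Q t w + A t%:Z w - S t%:Z w)%N.
Proof. by rewrite /Q /= (_ : t.+1%:Z - 1 = t%:Z)//; lia. Qed.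

Let mean_queue_fin t : mean P (Q t) \is a fin_num.
Proof.
elim: t => [|t IH].
  rewrite /mean (_ : (\int[P]_w _)%E = 0%E)// -[RHS](integral0 P setT).
  exact: eq_integral.
rewrite ge0_fin_numE ?mean_ge0//.
apply: (@le_lt_trans _ _ (mean P (Q t) + mean P (A t%:Z))%E).
  rewrite -(meanD P (mQ t t%:Z) (mA t%:Z)); apply: le_mean.
  - exact: mQ.
  - exact: measurable_fun_addn.
  by move=> w; rewrite QS leq_subr.
by rewrite mean_arrival lte_add_pinfty// ltey_eq ?IH ?mean_arrival_fin.
Qed.

(* If f L = 1 for every L, the queue started empty at time 0 is rarely below L,
   so service is rarely wasted and the mean queue length, with services capped at
   L to keep means finite, would eventually decrease linearly. *)
Lemma limit_tail_lt1 : exists L, limit_tail L < 1.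
Proof.
(* Services capped at this [L] still exceed arrivals in mean. *)
have [L AL] := mean_minn_gt (mS 0) (mean_lt 0); exists L.
pose SL n w := minn (S n w) L.
have mSL n : measurable_fun setT (SL n) := measurable_nat_comp (minn^~ L) (mS n).
have SLE n : mean P (SL n) = mean P (SL 0).
  exact: (mean_identically_distributed (minn^~ L) (iidS.1 n 0)).
have SLfin : mean P (SL 0) \is a fin_num.
  rewrite ge0_fin_numE ?mean_ge0//.
  apply: (@le_lt_trans _ _ (L%:R * pr setT)%:E); last exact: ltry.
  rewrite -mean_nat_indic//. apply: le_mean => //.
    by rewrite (_ : (fun w => _) = cst L); [exact: measurable_cst|
      apply/funext => w; rewrite in_setT muln1].
  by move=> w; rewrite in_setT muln1 geq_minr.
rewrite lt_neqAle limit_tail_le1 andbT; apply/eqP => L1.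
pose a := fine (mean P (A 0)); pose s := fine (mean P (SL 0)).
pose e t := fine (mean P (Q t)).
have lt_as : a < s by rewrite -lte_fin !fineK.
pose low t : set T := Q t @^-1` [set i | (i < L)%N].
have mlow t : measurable (low t) by exact/measurable_natI/mQ.
have prlow t : pr (low t) = 1 - queue_tail t L.
  have := pr_future_queue t L (future_setT t%:Z).
  rewrite setTI pr_setT mul1r => <-.
  have mge : measurable (queue t t%:Z @^-1` [set i | (L <= i)%N]).
    exact/measurable_natI/mQ.
  have := pr_setIC P measurableT mge; rewrite !setTI pr_setT => ->.
  rewrite addrAC subrr add0r; congr pr; apply/seteqP; split=> w; rewrite /low /Q /=; lia.
(* A queue of at least [L] uses the capped service in full; a shorter one wastes at most [L]. *)
have drift t : e t.+1 + s <= e t + a + L%:R * (1 - queue_tail t L).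
  rewrite -prlow -lee_fin !EFinD !fineK// -mean_nat_indic//.
  have mlowL : measurable_fun setT (fun w => (L * (w \in low t))%N).
    have -> : (fun w => (L * (w \in low t))%N) =
        (fun i => (L * (i < L))%N) \o Q t.
      by apply/funext => w /=; congr (_ * nat_of_bool _)%N; apply/idP/idP; rewrite inE.
    exact: measurable_nat_comp (mQ t t%:Z).
  rewrite -(mean_arrival t%:Z) -(SLE t%:Z)
    -(meanD P (mQ t.+1 t.+1%:Z) (mSL t%:Z)) -(meanD P (mQ t t%:Z) (mA t%:Z)).
  have mQA := measurable_fun_addn (mQ t t%:Z) (mA t%:Z).
  rewrite -(meanD P mQA mlowL); apply: le_mean.
  - by apply: measurable_fun_addn => //; exact: mQ.
  - exact: measurable_fun_addn.
  move=> w; have := QS t w; rewrite {1}/Q => ->; rewrite -/(Q t w) /SL.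
  have -> : (w \in low t) = (Q t w < L)%N by apply/idP/idP; rewrite inE.
  by case: (ltnP (Q t w) L) => QL; rewrite ?muln1 ?muln0; lia.
(* Half of the drift absorbs the wasted service; the other half is the decrease gained in each later
   slot, which would make the mean negative after [N] slots. *)
pose de := (s - a) / 2.
have de0 : 0 < de by rewrite /de; lra.
have [t0 lowt0] : exists t0, L%:R * (1 - queue_tail t0 L) <= de.
  apply: contrapT => /forallNP H.
  have : L%:R * limit_tail L <= L%:R - de.
    by apply: limit_tail_leM => t; have /negP := H t; rewrite -ltNge; lra.
  by rewrite L1; lra.
have low_t t : L%:R * (1 - queue_tail (t0 + t) L) <= de.
  apply: le_trans lowt0; rewrite ler_wpM2l// lerD2l lerN2.
  exact/queue_tail_homo/leq_addr.
have decr t : e (t0 + t)%N + t%:R * de <= e t0.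
  elim: t => [|t IH]; first by rewrite addn0 mul0r addr0.
  have := drift (t0 + t)%N; have := low_t t.
  rewrite addnS -natr1 mulrDl mul1r /de in IH *; lra.
have e0 t : 0 <= e t by apply: fine_ge0; exact: mean_ge0.
have [N eN] : exists N, e t0 < N%:R * de.
  exists (Num.truncn (e t0 / de)).+1.
  by rewrite -ltr_pdivrMr// truncnS_gt.
by have := decr N; have := e0 (t0 + N)%N; lra.
Qed.

End Drift.

(** * Mass functions of the queue before and after the arrival *)

Lemma future_arrival n U :
  future n (A n @^-1` U) /\ pr (A n @^-1` U) = pr (A 0 @^-1` U).
Proof.
have := future_slot U setT (future_setT (n + 1)).
rewrite addrK preimage_setT setIT setTI => -[fA _]; split => //.
by rewrite /pr prob_arrival.
Qed.

Lemma queue_before_eqE n k : [set w | queue_before R A S n w = k%:R%:E] =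
  eventually_ge n k `&` ~` eventually_ge n k.+1.
Proof.
apply/seteqP; split=> w /=.
  move/queue_before_eq => [[t kt] nk]; split; first by exists t.
  by case=> u _ ku; apply: nk; exists u.
case=> -[t _ kt] nk; apply/queue_before_eq; split; first by exists t.
by case=> u ku; apply: nk; exists u.
Qed.

Lemma measurable_queue_before_eq n k :
  measurable [set w | queue_before R A S n w = k%:R%:E].
Proof.
rewrite queue_before_eqE; apply: measurableI; last apply: measurableC;
  exact: measurable_eventually_ge.
Qed.

Definition limit_pmf k : R := limit_tail k - limit_tail k.+1.

Lemma pr_future_queue_before n E k : future n E ->
  pr (E `&` [set w | queue_before R A S n w = k%:R%:E]) = pr E * limit_pmf k.
Proof.
move=> fE; have mE := measurable_future fE.
have mX := @measurable_eventually_ge n.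
rewrite queue_before_eqE setIA /limit_pmf mulrBr -!(pr_future_eventually_ge _ fE).
have := pr_setIC P (measurableI _ _ mE (mX k)) (mX k.+1).
rewrite -[X in pr X + _]setIA (_ :
  eventually_ge n k `&` eventually_ge n k.+1 = eventually_ge n k.+1).
  by move=> ->; rewrite addrAC subrr add0r.
apply/setIidr => w [t _ /= kt]; exists t => //=; exact: ltnW.
Qed.

Lemma queue_before_has_pmf n :
  has_pmf P (queue_before R A S n) limit_pmf.
Proof.
move=> k; rewrite prE; last exact: measurable_queue_before_eq.
rewrite -[X in pr X]setTI (pr_future_queue_before k (future_setT n)).
by rewrite pr_setT mul1r.
Qed.

Lemma queue_before_ge0 n w : (0 <= queue_before R A S n w)%E.
Proof. by apply/(queue_before_ge n w 0); exists 0%N. Qed.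

(** Events of [A n] are future events at time [n], hence independent of the queue before it. Since
    that queue is nonnegative, only arrivals j <= k contribute. *)
Lemma queue_after_has_pmf n : has_pmf P (queue_after R A S n)
  (fun k => \sum_(j < k.+1) arrival_pmf j * limit_pmf (k - j)).
Proof.
move=> k; set Yk := [set w | _].
have YkA j : Yk `&` A n @^-1` [set j] = if (j <= k)%N then
    A n @^-1` [set j] `&` [set w | queue_before R A S n w = (k - j)%:R%:E]
    else set0.
  apply/seteqP; split=> w; rewrite /Yk /queue_after /=.
    case=> Xk Aj; rewrite Aj in Xk; have X0 := queue_before_ge0 n w.
    have Xr : queue_before R A S n w = (k%:R - j%:R)%:E.
      by rewrite EFinB -Xk addeK.
    case: leqP => [jk|kj]; first by split=> //=; rewrite natrB.
    by move: X0; rewrite Xr lee_fin subr_ge0 ler_nat leqNgt kj.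
  case: leqP => // jk [/= Aj ->]; split => //.
  by rewrite Aj natrB// -EFinD subrK.
have mYk : measurable Yk.
  rewrite (_ : Yk = \bigcup_j (Yk `&` A n @^-1` [set j])); last first.
    by apply/seteqP; split => [w Yw|w [j _ []]//]; exists (A n w).
  apply: bigcupT_measurable => j; rewrite YkA; case: leqP => // _.
  apply: measurableI; last exact: measurable_queue_before_eq.
  exact: measurable_funPTI.
rewrite prE// (@pr_sum_lt _ _ _ P _ (A n) k.+1) ?measurable_funPT//.
rewrite [X in _ + X](_ : _ = 0) ?addr0.
  congr EFin; apply: eq_bigr => j _; rewrite YkA -ltnS ltn_ord.
  have [fA prA] := future_arrival n [set (j : nat)].
  by rewrite pr_future_queue_before// prA.
rewrite -(pr_set0 P); congr pr; apply/seteqP; split=> // w [Yw /= kA].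
have := YkA (A n w); rewrite leqNgt kA /= => E0.
by have : (Yk `&` A n @^-1` [set A n w]) w by []; rewrite E0.
Qed.

Lemma arrival_pmf_of_has_pmf n (f : nat -> R) :
  has_pmf P (fun w => (A n w)%:R%:E) f -> arrival_pmf =1 f.
Proof.
move=> fA k; apply: EFin_inj; rewrite -fA -prE; last exact: measurable_funPTI.
rewrite -(prob_arrival n); congr (P _); apply/seteqP; split=> w /=.
  by move=> ->.
by case=> /eqP; rewrite eqr_nat => /eqP.
Qed.

Lemma arrival_tail0 : arrival_tail 0 = 1.
Proof. by rewrite -(pr_setT P); congr pr; apply/seteqP. Qed.

(** * Geometric form of the limiting laws *)

Section Conclusion.
Hypothesis meanAS : forall n : int,
  ('E_P[fun w => (A n w)%:R] < 'E_P[fun w => (S n w)%:R])%E.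

(** If q were 1, the ratio 1 - al + al q would be 1 and every tail would equal 1, against the
    drift. *)
Lemma limit_tail1_lt1 al : 0 < al <= 1 ->
  (forall m, (0 < m)%N -> arrival_tail m.+1 = (1 - al) * arrival_tail m) ->
  limit_tail 1 < 1.
Proof.
move=> al01 tailA; rewrite lt_neqAle limit_tail_le1 andbT; apply/eqP => q1.
have [[|L]] := limit_tail_lt1 meanAS; first by rewrite limit_tail0 ltxx.
by rewrite (limit_tail_geometric al01 tailA) q1 mulr1 subrK expr1n mulr1 ltxx.
Qed.

Section BerGeomArrivals.
Variables p al : R.
Hypotheses (al01 : 0 < al < 1) (pmfA : arrival_pmf =1 ber_geom_pmf p al).

Lemma ber_geom_tail m : arrival_tail m.+1 = p * (1 - al) ^+ m.
Proof.
elim: m => [|m IH].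
  by have := arrival_tailE 0; rewrite arrival_tail0 pmfA /= expr0; lra.
have := arrival_tailE m.+1; rewrite IH pmfA /= exprS; lra.
Qed.

Let tailA m : (0 < m)%N -> arrival_tail m.+1 = (1 - al) * arrival_tail m.
Proof. by case: m => // m _; rewrite !ber_geom_tail exprS mulrCA. Qed.

Let al01' : 0 < al <= 1.
Proof. by case/andP: al01 => -> /ltW. Qed.

Lemma ber_geom_limit1_lt1 : limit_tail 1 < 1.
Proof. exact: limit_tail1_lt1 tailA. Qed.

Lemma ber_geom_limit_param : 0 < al * (1 - limit_tail 1) < 1.
Proof.
case/andP: al01 => al0 al1; have q1 := ber_geom_limit1_lt1.
have q0 := limit_tail_ge0 1.
have q1' : 0 < 1 - limit_tail 1 by lra.
rewrite mulr_gt0//=; have := mulr_ge0 (ltW al0) q0; lra.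
Qed.

Lemma ber_geom_limit_pmf :
  limit_pmf =1 ber_geom_pmf (limit_tail 1) (al * (1 - limit_tail 1)).
Proof.
case=> [|k]; rewrite /limit_pmf /=; first by rewrite limit_tail0.
rewrite (limit_tail_geometric al01' tailA k.+1) (limit_tail_geometric al01' tailA k) exprS.
have -> : 1 - al * (1 - limit_tail 1) = 1 - al + al * limit_tail 1 by ring.
by ring.
Qed.

End BerGeomArrivals.
End Conclusion.
End BatchQueue.

(** With a = al (1 - q), the generating function of BerGeom(q, a) is (1 - q) (1 - (1 - al) z) / (1 -
    (1 - a) z). Its numerator cancels the denominator 1 - (1 - al) z of BerGeom(p, al). *)
Lemma ber_geom_convolution (R : realType) (p q al : R) (k : nat) :
  \sum_(j < k.+1) ber_geom_pmf p al j *
    ber_geom_pmf q (al * (1 - q)) (k - j) =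
  ber_geom_pmf (1 - (1 - p) * (1 - q)) (al * (1 - q)) k.
Proof.
set a := al * (1 - q); set x := ber_geom_pmf q a; set y := ber_geom_pmf p al.
pose c k := \sum_(j < k.+1) y j * x (k - j)%N.
rewrite -/(c k).
have c0 : c 0%N = (1 - p) * (1 - q) by rewrite /c big_ord_recr big_ord0 /= add0r.
(* The cancellation read on coefficients; the last bracket vanishes for i >= 1, leaving a geometric
   sequence. *)
have cS i : c i.+1 = (1 - a) * c i + (1 - q) * (y i.+1 - (1 - al) * y i).
  rewrite /c big_ord_recr/= subnn big_ord_recr/= [in RHS]big_ord_recr/= subSnn subnn.
  have -> : \sum_(j < i) y j * x (i.+1 - j)%N =
            (1 - a) * \sum_(j < i) y j * x (i - j)%N.
    rewrite mulr_sumr; apply: eq_bigr => j _.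
    rewrite subSn; last exact: ltnW.
    have : (0 < i - j)%N by rewrite subn_gt0.
    by case: (i - j)%N => // m _; rewrite /x /= exprS; ring.
  by rewrite /x /= expr0 /a; ring.
case: k => [|k]; first by rewrite c0 /=; ring.
elim: k => [|k IH].
  by rewrite cS c0 /y /= expr0 /a; ring.
by rewrite cS IH /y /= !exprS; ring.
Qed.

(** Both geometric laws are BerGeom laws, with p = 1 here and p = 1 - a in the next lemma, which
    reduces (c) to the law of Y found for (a). *)
Lemma geomp_ber_geom (R : realType) (a : R) :
  geomp_pmf a =1 ber_geom_pmf 1 a.
Proof. by case=> [|k] /=; rewrite ?subrr ?mul1r. Qed.

Lemma geom0_ber_geom (R : realType) (a : R) :
  geom0_pmf a =1 ber_geom_pmf (1 - a) a.
Proof. by case=> [|k]; rewrite /geom0_pmf /= ?expr0 ?exprS; ring. Qed.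

Lemma eq_has_pmf d (T : measurableType d) (R : realType) (P : probability T R)
    (Z : T -> \bar R) (f g : nat -> R) : f =1 g -> has_pmf P Z f -> has_pmf P Z g.
Proof. by move=> fg fZ k; rewrite fZ fg. Qed.

(** * Assembling (a), (b) and (c) *)

Unset Implicit Arguments.

Theorem theorem4p3 (R : realType) (d : measure_display) (T : measurableType d)
    (P : probability T R) (A S : int -> {RV P >-> nat})
    (iidA : iid A) (iidS : iid S) (indepAS : independent_families A S)
    (meanAS : forall n : int,
       ('E_P[fun w => (A n w)%:R] < 'E_P[fun w => (S n w)%:R])%E)
    (n : int) :
  let X : T -> \bar R := queue_before R A S n in
  let Y : T -> \bar R := queue_after R A S n in
  let An : T -> \bar R := fun w => (A n w)%:R%:E in
  [/\ has_ber_geom P An -> has_ber_geom P X /\ has_ber_geom P Y,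
      {ae P, forall w, A n w = 0%N \/ A n w = 1%N} ->
        exists a : R,
          [/\ 0 < a <= 1,
              (0 < P [set w | A n w = 1%N])%E ->
                (0 < P [set w | S n w = 0%N])%E -> a < 1
            & has_pmf P X (geom0_pmf a)],
      has_geom0 P An -> has_geom0 P Y
    & has_geomp P An -> has_geomp P Y].
Proof.
move=> X Y An.
pose q := limit_tail A S 1.
have q0 : 0 <= q := limit_tail_ge0 A S 1.
have beX := queue_before_has_pmf iidA iidS indepAS n.
have beY p al : 0 < al < 1 -> has_pmf P An (ber_geom_pmf p al) ->
    [/\ q < 1, 0 < al * (1 - q) < 1,
        has_pmf P X (ber_geom_pmf q (al * (1 - q)))
      & has_pmf P Y (ber_geom_pmf (1 - (1 - p) * (1 - q)) (al * (1 - q)))].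
  move=> al01 /(arrival_pmf_of_has_pmf iidA) pmfA.
  have pmfX := ber_geom_limit_pmf iidA iidS indepAS al01 pmfA.
  split.
  - exact: ber_geom_limit1_lt1 pmfA.
  - exact: ber_geom_limit_param pmfA.
  - exact: eq_has_pmf pmfX beX.
  - apply: eq_has_pmf (queue_after_has_pmf iidA iidS indepAS n) => k.
    rewrite -ber_geom_convolution; apply: eq_bigr => j _.
    by rewrite pmfA pmfX.
split.
- move=> [p [al [/andP[p0 p1] al01 pmfA]]].
  have [q1 a01 pX pY] := beY _ _ al01 pmfA; split.
    by exists q, (al * (1 - q)); rewrite q0 ltW.
  exists (1 - (1 - p) * (1 - q)), (al * (1 - q)); split => //.
  have : (1 - p) * (1 - q) <= 1 * 1 by apply: ler_pM; lra.
  have : 0 <= (1 - p) * (1 - q) by apply: mulr_ge0; lra.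
  lra.
- move=> A01.
  have tail2 m : (1 < m)%N -> arrival_tail A m = 0.
    move=> m2; apply: EFin_inj; rewrite -prE; last exact: measurable_funPTI.
    rewrite -(prob_arrival iidA n); apply: measure_negligible.
      exact: measurable_funPTI.
    by apply: negligibleS A01 => w /= mA [] Aw; rewrite Aw in mA; lia.
  (* Arrivals in {0, 1} are the case al = 1: the ratio becomes q, so the tails are the powers of
     q. *)
  have one01 : 0 < (1 : R) <= 1 by rewrite ltr01 lexx.
  have tailA m : (0 < m)%N -> arrival_tail A m.+1 = (1 - 1) * arrival_tail A m.
    by move=> m0; rewrite tail2// subrr mul0r.
  have q1 : q < 1 := limit_tail1_lt1 iidA iidS indepAS meanAS one01 tailA.
  exists (1 - q); split; first lra.
    move=> A1 S0; suff : 0 < q by lra.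
    apply: limit_tail1_gt0 => //; rewrite -lte_fin -prE;
      try exact: measurable_funPTI.
      by rewrite -(prob_arrival iidA n).
    by rewrite -(prob_service iidS n).
  apply: eq_has_pmf beX => k; rewrite /limit_pmf.
  have tq i : limit_tail A S i = q ^+ i.
    case: i => [|i]; first by rewrite limit_tail0.
    rewrite (limit_tail_geometric iidA iidS indepAS one01 tailA).
    by rewrite subrr add0r mul1r exprS.
  by rewrite !tq /geom0_pmf /= exprS subKr; ring.
- move=> [al [al01 pmfA]].
  have [q1 a01 _ pY] := beY _ _ al01 (eq_has_pmf (geom0_ber_geom al) pmfA).
  (* With p = 1 - al the Bernoulli parameter of Y is 1 - al (1 - q), which is again one minus the
     geometric parameter. *)
  exists (al * (1 - q)); split => //; apply: eq_has_pmf pY => k.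
  rewrite geom0_ber_geom; congr (ber_geom_pmf _ _ _); ring.
- move=> [al [al01 pmfA]].
  have [q1 a01 _ pY] := beY _ _ al01 (eq_has_pmf (geomp_ber_geom al) pmfA).
  exists (al * (1 - q)); split => //; apply: eq_has_pmf pY => k.
  by rewrite geomp_ber_geom subrr mul0r subr0.
Qed.
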